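(* Let $(\bar M,\bar g,\bar\zeta,\lambda)$ be a Ricci soliton, where $\bar M={}_fI\times_\sigma M$ is a doubly warped spacetime with metric $\bar g=-f^2dt^2\oplus\sigma^2g$, and $\bar\zeta=h\partial_t+\zeta\in\mathfrak X(\bar M)$ is a conformal vector field on $\bar M$ with factor $2\rho$. Then $(M,g)$ is an Einstein manifold with factor $\mu=(\lambda-\rho)\sigma^2+\dfrac{\sigma^{\diamond}}{f^2}$ if $f$ is constant.
   Context: $(M,g)$ is a Riemannian manifold of dimension $n$, $I$ is an open connected interval with metric $g_I=-dt^2$, and $f:M\to(0,\infty)$, $\sigma:I\to(0,\infty)$ are smooth. The doubly warped spacetime ${}_fI\times_\sigma M$ is $I\times M$ with the metric $\bar g=-f^2dt^2\oplus\sigma^2g$; $h:I\to\mathbb R$ is smooth and $\zeta\in\mathfrak X(M)$ (identified with its lift). $(N,k,\zeta,\lambda)$ is a Ricci soliton if $\frac12\mathcal L_\zeta k+\mathrm{Ric}=\lambda k$ with $\lambda$ a real constant. A vector field $\zeta$ on $(N,k)$ is conformal with factor $2\rho$ ($\rho$ a smooth function) if $\mathcal L_\zeta k=2\rho k$. $(M,g)$ is Einstein with factor $\mu$ if $\mathrm{Ric}=\mu g$. The notation $\sigma^\diamond$ means $\sigma^{\diamond}=\sigma\,\Delta^I\sigma+(n-1)\,g_I(\nabla^I\sigma,\nabla^I\sigma)$, where $\nabla^I$ and $\Delta^I$ are the gradient and Laplacian (divergence of the gradient) of $(I,g_I)$. *)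

(* Defs.v *)
From HB Require Import structures.
From mathcomp Require Import all_boot all_order all_algebra.
From mathcomp Require Import all_classical all_reals topology normedtype derive.
Set Implicit Arguments.
Unset Strict Implicit.
Unset Printing Implicit Defensive.
Import Order.TTheory GRing.Theory Num.Theory.
Import numFieldTopology.Exports numFieldNormedType.Exports.
Local Open Scope classical_set_scope.
Local Open Scope ring_scope.

(* [unchart a] is total; only its values on [chart a @` dom a] matter. *)
Record charts (R : realType) (n : nat) (M : topologicalType) := Charts {
  idx : Type;
  dom : idx -> set M;
  chart : idx -> M -> 'rV[R]_n;
  unchart : idx -> 'rV[R]_n -> M }.

Section ChartCalculus.
Context {R : realType} {n : nat} {M : topologicalType} (A : charts R n M).
Implicit Types (a b : idx A) (u : M -> R) (U : set M) (i : 'I_n).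

Definition ebase i : 'rV[R]_n := delta_mx 0 i.

(* d u / d x^i in the chart a, as a function on M (meaningful on dom a). *)
Definition partial a i u (x : M) : R :=
  'D_(ebase i) (u \o unchart a) (chart a x).

(* u is of class C^k on U in the chart a: every iterated partial derivative of
   order at most k exists and is continuous on U. *)
Fixpoint Ck a U (k : nat) u : Prop :=
  (forall x, U x -> {for x, continuous u}) /\
  match k with
  | 0%N => True
  | k'.+1 => forall i,
      (forall x, U x ->
         derivable (u \o unchart a) (chart a x) (ebase i)) /\
      Ck a U k' (partial a i u)
  end.

Definition smooth_on a U u : Prop := forall k, Ck a U k u.

(* jacobian a b x i j = d (x_b)^j / d (x_a)^i *)
Definition jac a b (x : M) : 'M[R]_n :=
  \matrix_(i, j) partial a i (fun y => chart b y 0 j) x.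

End ChartCalculus.

Record manifold (R : realType) (n : nat) := Manifold {
  carrier :> topologicalType;
  atlas : charts R n carrier;
  manifold_hausdorff : hausdorff_space carrier;
  manifold_second_countable : @second_countable carrier;
  dom_open : forall a : idx atlas, open (dom a);
  dom_cover : forall x, exists a : idx atlas, dom a x;
  chart_open : forall a : idx atlas, open (chart a @` dom a);
  chartK : forall (a : idx atlas) x, dom a x -> unchart a (chart a x) = x;
  chart_continuous : forall (a : idx atlas) x, dom a x ->
    {for x, continuous (chart a)};
  unchart_continuous : forall (a : idx atlas) z, (chart a @` dom a) z ->
    {for z, continuous (unchart a)};
  transition_smooth : forall (a b : idx atlas) (j : 'I_n),
    smooth_on a (dom a `&` dom b) (fun x => chart b x 0 j) }.

Arguments atlas {R n} m.

Definition chart_of {R : realType} {n : nat} (M : manifold R n) := idx (atlas M).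

Section Reparam.
Context {R : realType} {V W : normedModType R}.
Variables (f : V -> R) (g : W -> R) (a v : V) (b w : W).
Hypothesis fg : forall h : R, f (h *: v + a) = g (h *: w + b).

Let quotE : (fun h : R => h^-1 *: ((f \o shift a) (h *: v) - f a)) =
            (fun h : R => h^-1 *: ((g \o shift b) (h *: w) - g b)).
Proof.
apply/funext => h /=; rewrite fg; congr (_ *: (_ - _)).
by have := fg 0; rewrite !scale0r !add0r.
Qed.

Lemma derive_reparam : 'D_v f a = 'D_w g b.
Proof. by rewrite /derive quotE. Qed.

Lemma derivable_reparam : derivable g b w -> derivable f a v.
Proof. by rewrite /derivable quotE. Qed.
End Reparam.

Section CkLemmas.
Context {R : realType} {n : nat} {M : topologicalType} (A : charts R n M).
Lemma partial_cst (a : idx A) i (c : R) : partial a i (fun=> c) = fun=> 0.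
Proof.
apply/funext => x; rewrite /partial.
by rewrite (_ : _ \o _ = cst c) ?derive_cst.
Qed.

Lemma Ck_cst (a : idx A) U k (c : R) : Ck a U k (fun=> c).
Proof.
elim: k c => [|k IH] c /=; split => //; try by move=> x _; exact: cst_continuous.
move=> i; split; last by rewrite partial_cst.
by move=> x _; exact: (@derivable_cst _ _ _ c).
Qed.
End CkLemmas.

Section Product.
Context {R : realType} {m n : nat} {M N : topologicalType}.
Variables (A : charts R m M) (B : charts R n N).

Definition prod_charts : charts R (m + n) (M * N)%type := {|
  idx := (idx A * idx B)%type;
  dom := fun c => dom c.1 `*` dom c.2;
  chart := fun c p => row_mx (chart c.1 p.1) (chart c.2 p.2);
  unchart := fun c z => (unchart c.1 (lsubmx z), unchart c.2 (rsubmx z)) |}.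

Lemma lsub_ebase i : lsubmx (@ebase R (m + n) (lshift n i)) = ebase i.
Proof. by apply/rowP => j; rewrite !mxE /= eq_lshift. Qed.
Lemma lsub_ebase0 i : lsubmx (@ebase R (m + n) (rshift m i)) = 0.
Proof. by apply/rowP => j; rewrite !mxE /= eq_lrshift. Qed.
Lemma rsub_ebase i : rsubmx (@ebase R (m + n) (rshift m i)) = ebase i.
Proof. by apply/rowP => j; rewrite !mxE /= eq_rshift. Qed.
Lemma rsub_ebase0 i : rsubmx (@ebase R (m + n) (lshift n i)) = 0.
Proof. by apply/rowP => j; rewrite !mxE /= eq_rlshift. Qed.

Lemma partial_fstl (c : idx prod_charts) i u :
  partial c (lshift n i) (fun p => u p.1) = fun p => partial c.1 i u p.1.
Proof.
apply/funext => p; apply: derive_reparam => h /=.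
by rewrite !linearD !linearZ /= row_mxKl lsub_ebase.
Qed.
Lemma partial_fstr (c : idx prod_charts) i (u : M -> R) :
  partial c (rshift m i) (fun p => u p.1) = fun=> 0.
Proof.
apply/funext => p; rewrite -(derive0 (u \o unchart c.1) (chart c.1 p.1)).
apply: derive_reparam => h /=.
by rewrite !linearD !linearZ /= row_mxKl lsub_ebase0.
Qed.
Lemma partial_sndr (c : idx prod_charts) i u :
  partial c (rshift m i) (fun p => u p.2) = fun p => partial c.2 i u p.2.
Proof.
apply/funext => p; apply: derive_reparam => h /=.
by rewrite !linearD !linearZ /= row_mxKr rsub_ebase.
Qed.
Lemma partial_sndl (c : idx prod_charts) i (u : N -> R) :
  partial c (lshift n i) (fun p => u p.2) = fun=> 0.
Proof.
apply/funext => p; rewrite -(derive0 (u \o unchart c.2) (chart c.2 p.2)).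
apply: derive_reparam => h /=.
by rewrite !linearD !linearZ /= row_mxKr rsub_ebase0.
Qed.

Lemma Ck_fst (c : idx prod_charts) U V k u :
  Ck c.1 U k u -> V `<=` [set p | U p.1] -> Ck c V k (fun p => u p.1).
Proof.
move=> + VU; elim: k u => [|k IH] u /= [uc ud]; split => //.
- by move=> p /VU Up; apply: (@continuous_comp _ _ _ fst u p); [exact: cvg_fst|exact: uc].
- by move=> p /VU Up; apply: (@continuous_comp _ _ _ fst u p); [exact: cvg_fst|exact: uc].
move=> i; case: (split_ordP i) => j ->.
  have [d1 d2] := ud j; split; last by rewrite partial_fstl; exact: IH.
  move=> p /VU /d1; apply: derivable_reparam => h /=.
  by rewrite !linearD !linearZ /= row_mxKl lsub_ebase.
split; last by rewrite partial_fstr; exact: Ck_cst.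
move=> p _.
have := @derivable0 _ _ _ (u \o unchart c.1) (chart c.1 p.1).
apply: derivable_reparam => h /=.
by rewrite !linearD !linearZ /= row_mxKl lsub_ebase0.
Qed.

Lemma Ck_snd (c : idx prod_charts) U V k u :
  Ck c.2 U k u -> V `<=` [set p | U p.2] -> Ck c V k (fun p => u p.2).
Proof.
move=> + VU; elim: k u => [|k IH] u /= [uc ud]; split => //.
- by move=> p /VU Up; apply: (@continuous_comp _ _ _ snd u p); [exact: cvg_snd|exact: uc].
- by move=> p /VU Up; apply: (@continuous_comp _ _ _ snd u p); [exact: cvg_snd|exact: uc].
move=> i; case: (split_ordP i) => j ->; last first.
  have [d1 d2] := ud j; split; last by rewrite partial_sndr; exact: IH.
  move=> p /VU /d1; apply: derivable_reparam => h /=.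
  by rewrite !linearD !linearZ /= row_mxKr rsub_ebase.
split; last by rewrite partial_sndl; exact: Ck_cst.
move=> p _.
have := @derivable0 _ _ _ (u \o unchart c.2) (chart c.2 p.2).
apply: derivable_reparam => h /=.
by rewrite !linearD !linearZ /= row_mxKr rsub_ebase0.
Qed.

End Product.

Lemma hausdorff_prod (S T : topologicalType) :
  hausdorff_space S -> hausdorff_space T -> hausdorff_space (S * T)%type.
Proof.
move=> hS hT [p1 p2] [q1 q2] pq; congr (_, _).
  apply: hS => A B pA qB.
  have [[x y] [/= Ax Bx]] : (fst @^-1` A : set (S * T)) `&` (fst @^-1` B) !=set0.
    by apply: pq; [exact: (@cvg_fst _ _ (nbhs p1) (nbhs p2) _ A pA)|
                   exact: (@cvg_fst _ _ (nbhs q1) (nbhs q2) _ B qB)].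
  by exists x.
apply: hT => A B pA qB.
have [[x y] [/= Ax Bx]] : (snd @^-1` A : set (S * T)) `&` (snd @^-1` B) !=set0.
  by apply: pq; [exact: (@cvg_snd _ _ (nbhs p1) (nbhs p2) _ A pA)|
                   exact: (@cvg_snd _ _ (nbhs q1) (nbhs q2) _ B qB)].
by exists y.
Qed.

Lemma second_countable_prod (S T : topologicalType) :
  @second_countable S -> @second_countable T -> @second_countable (S * T)%type.
Proof.
move=> [B cB [oB bB]] [C cC [oC bC]].
exists [set X.1 `*` X.2 | X in B `*` C].
  by apply: sub_countable (card_image_le _ _) _; exact: countableX.
split.
  move=> _ [[X Y] /= [/oB oX /oC oY] <-].
  rewrite openE => -[x y] [/= Xx Yy].
  by exists (X, Y) => //; split; exact: open_nbhs_nbhs.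
move=> [x y] P [[X Y] /= [/bB [X' [BX' X'x] X'X] /bC [Y' [CY' Y'y] Y'Y]] XYP].
exists (X' `*` Y'); last by move=> z [/X'X ? /Y'Y ?]; exact: XYP.
by split => //; exists (X', Y').
Qed.

Lemma cvg_row_mx (R : realType) (m n : nat) (T : Type) (F : set_system T)
    {FF : Filter F} (f : T -> 'rV[R]_m) (g : T -> 'rV[R]_n)
    (x : 'rV[R]_m) (y : 'rV[R]_n) :
  f @ F --> x -> g @ F --> y ->
  (fun t => row_mx (f t) (g t)) @ F --> (row_mx x y : 'rV[R]_(m + n)).
Proof.
move=> /cvg_ballP fx /cvg_ballP gy; apply/cvg_ballP => e e0.
have := fx e e0; have := gy e e0; apply: filterS2 => t [_ gt] [_ ft].
split=> // i j; case: (split_ordP j) => k ->.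
  by rewrite !row_mxEl.
by rewrite !row_mxEr.
Qed.

Section Product2.
Context {R : realType} {m n : nat} (M : manifold R m) (N : manifold R n).
Local Notation P := (prod_charts (atlas M) (atlas N)).

Lemma prod_dom_open (c : idx P) : open (dom c).
Proof.
rewrite openE => -[x y] [/= cx cy].
by exists (dom c.1, dom c.2) => //=; split; apply: open_nbhs_nbhs; split => //; exact: dom_open.
Qed.

Lemma prod_dom_cover x : exists c : idx P, dom c x.
Proof.
have [a ax] := dom_cover x.1; have [b bx] := dom_cover x.2.
by exists (a, b).
Qed.

Lemma prod_imageP (c : idx P) z : (chart c @` dom c) z <->
  (chart c.1 @` dom c.1) (lsubmx z) /\ (chart c.2 @` dom c.2) (rsubmx z).
Proof.
split=> [[p [/= p1 p2] <-]|[[x cx xz] [y cy yz]]].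
  by rewrite row_mxKl row_mxKr; split; [exists p.1|exists p.2].
by exists (x, y) => //=; rewrite xz yz hsubmxK.
Qed.

Lemma prod_chart_open (c : idx P) : open (chart c @` dom c).
Proof.
rewrite (_ : _ @` _ = (lsubmx @^-1` (chart c.1 @` dom c.1)) `&`
   (rsubmx @^-1` (chart c.2 @` dom c.2))); last first.
  by apply/seteqP; split => z /prod_imageP.
apply: openI; apply: open_comp; try exact: chart_open.
  by move=> z _; exact: continuous_lsubmx.
by move=> z _; exact: continuous_rsubmx.
Qed.

Lemma prod_chartK (c : idx P) x : dom c x -> unchart c (chart c x) = x.
Proof.
by case: x => x y [/= cx cy]; rewrite row_mxKl row_mxKr !chartK.
Qed.

Lemma prod_chart_continuous (c : idx P) x : dom c x ->
  {for x, continuous (chart c)}.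
Proof.
move=> [/= c1 c2]; apply: cvg_row_mx.
  apply: (@continuous_comp _ _ _ fst (chart c.1) x); first exact: cvg_fst.
  exact: chart_continuous.
apply: (@continuous_comp _ _ _ snd (chart c.2) x); first exact: cvg_snd.
exact: chart_continuous.
Qed.

Lemma prod_unchart_continuous (c : idx P) z : (chart c @` dom c) z ->
  {for z, continuous (unchart c)}.
Proof.
move=> /prod_imageP [z1 z2].
have H1 : {for z, continuous (unchart c.1 \o @lsubmx R 1 m n)}.
  by apply: continuous_comp; [exact: continuous_lsubmx|exact: unchart_continuous].
have H2 : {for z, continuous (unchart c.2 \o @rsubmx R 1 m n)}.
  by apply: continuous_comp; [exact: continuous_rsubmx|exact: unchart_continuous].
exact: (cvg_pair H1 H2).
Qed.

Lemma prod_transition_smooth (c d : idx P) (j : 'I_(m + n)) :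
  smooth_on c (dom c `&` dom d) (fun x => chart d x 0 j).
Proof.
move=> k; case: (split_ordP j) => i ->.
  rewrite (_ : (fun x => _) = fun p => chart d.1 p.1 0 i); last first.
    by apply/funext => p /=; rewrite row_mxEl.
  apply: (@Ck_fst _ _ _ _ _ _ _ c (dom c.1 `&` dom d.1) _ k
    (fun x => chart d.1 x 0 i)); first exact: transition_smooth.
  by move=> p [[? ?] [? ?]].
rewrite (_ : (fun x => _) = fun p => chart d.2 p.2 0 i); last first.
  by apply/funext => p /=; rewrite row_mxEr.
apply: (@Ck_snd _ _ _ _ _ _ _ c (dom c.2 `&` dom d.2) _ k
  (fun x => chart d.2 x 0 i)); first exact: transition_smooth.
by move=> p [[? ?] [? ?]].
Qed.

Definition prod_manifold : manifold R (m + n) := {|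
  carrier := (M * N)%type;
  atlas := P;
  manifold_hausdorff :=
    hausdorff_prod (@manifold_hausdorff _ _ M) (@manifold_hausdorff _ _ N);
  manifold_second_countable := second_countable_prod
    (@manifold_second_countable _ _ M) (@manifold_second_countable _ _ N);
  dom_open := prod_dom_open;
  dom_cover := prod_dom_cover;
  chart_open := prod_chart_open;
  chartK := prod_chartK;
  chart_continuous := prod_chart_continuous;
  unchart_continuous := prod_unchart_continuous;
  transition_smooth := prod_transition_smooth |}.

End Product2.

Lemma hausdorff_set_type (X : topologicalType) (A : set X) :
  hausdorff_space X -> hausdorff_space (set_type A).
Proof.
move=> hX x y xy; apply: val_inj; apply: hX => U V xU yV.
have [z [/= Uz Vz]] : (set_val @^-1` U : set (set_type A)) `&` (set_val @^-1` V) !=set0.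
  by apply: xy; apply: (@initial_continuous _ _ (@set_val X A)).
by exists (set_val z).
Qed.

Lemma second_countable_set_type (X : topologicalType) (A : set X) :
  @second_countable X -> @second_countable (set_type A).
Proof.
move=> [B cB [oB bB]].
exists [set (set_val @^-1` U : set (set_type A)) | U in B].
  exact: sub_countable (card_image_le _ _) _.
split.
  by move=> _ [U /oB oU <-]; exists U.
move=> x P; rewrite nbhsE => -[_ [[U oU <-] Ux] UP].
have [V [BV Vx] VU] := bB (set_val x) U (open_nbhs_nbhs (conj oU Ux)).
exists (set_val @^-1` V); first by split => //; exists V.
by move=> y /VU; exact: UP.
Qed.

Lemma second_countable_real (R : realType) : @second_countable R.
Proof.
exists [set (`]ratr p.1, ratr p.2[%classic : set R) | p in [set: rat * rat]].
  by apply: sub_countable (card_image_le _ _) _; exact: countableP.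
split; first by move=> _ [p _ <-]; exact: interval_open.
move=> x P /nbhs_ballP [e /= e0 eP].
have [q1 q1x] : exists q : rat, x - e < ratr q < x.
  have /rat_in_itvoo [q] : x - e < x by rewrite ltrBlDr ltrDl.
  by rewrite in_itv /=; exists q.
have [q2 q2x] : exists q : rat, x < ratr q < x + e.
  have /rat_in_itvoo [q] : x < x + e by rewrite ltrDl.
  by rewrite in_itv /=; exists q.
have /andP[q11 q12] := q1x; have /andP[q21 q22] := q2x.
exists (`]ratr q1, ratr q2[)%classic.
  by split; [exists (q1, q2)|rewrite /= in_itv /= q12].
move=> y /=; rewrite in_itv /= => /andP[y1 y2]; apply: eP.
rewrite /ball /= ltr_distlC; apply/andP; split.
  exact: lt_trans y1.
exact: lt_trans q22.
Qed.

(* A nonempty open subset I of R as a 1-manifold with the inclusion as chart; off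
   I, the inverse chart takes an arbitrary value. *)
Section OpenSet.
Context {R : realType} (I : set R) (I_open : open I) (I_neq0 : I !=set0).

Let t0 : set_type I := SigSub (mem_set (projT2 (cid I_neq0))).

Definition interval_charts : charts R 1 (set_type I) := {|
  idx := unit;
  dom := fun=> setT;
  chart := fun _ t => const_mx (set_val t);
  unchart := fun _ z => insubd t0 (z 0 0) |}.

Local Notation J := interval_charts.

Lemma interval_chartK (a : idx J) x : dom a x -> unchart a (chart a x) = x.
Proof. by move=> _ /=; rewrite mxE; exact: valKd. Qed.

Lemma interval_imageE (a : idx J) : chart a @` dom a = [set z | I (z 0 0)].
Proof.
apply/seteqP; split => [_ [t _ <-]|z Iz] /=.
  by rewrite mxE; exact/set_mem/valP.
have Iz' : z 0 0 \in I := mem_set Iz.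
exists (SigSub Iz') => //=.
by apply/matrixP => i j; rewrite mxE !ord1.
Qed.

Lemma interval_chart_open (a : idx J) : open (chart a @` dom a).
Proof.
rewrite interval_imageE; apply: (@open_comp _ _ (fun z : 'rV[R]_1 => z 0 0)) => //.
by move=> z _; exact: coord_continuous.
Qed.

Lemma interval_chart_continuous (a : idx J) x : dom a x ->
  {for x, continuous (chart a)}.
Proof.
move=> _; apply/(@cvg_ballP _ _ _ _ (@nbhs_filter (set_type I) x)) => e e0.
have := @initial_continuous _ _ (@set_val R I) x _ (nbhsx_ballx (set_val x) e e0).
by apply: (@filterS _ _ (@nbhs_filter (set_type I) x)) => t xt; split=> // i j; rewrite !mxE.
Qed.

Lemma interval_unchart_continuous (a : idx J) z : (chart a @` dom a) z ->
  {for z, continuous (unchart a)}.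
Proof.
rewrite interval_imageE => /= Iz P; rewrite nbhsE => -[_ [[U oU <-] Uz] UP].
have {}Uz : U (z 0 0).
  by move: Uz; rewrite /preimage /= set_valE insubdK //; exact/mem_set.
have : \forall w \near z, (U `&` I) ((w : 'rV[R]_1) 0 0).
  apply: (@coord_continuous _ 1 1 0 0 z).
  by apply: open_nbhs_nbhs; split => //; exact: openI.
apply: filterS => w [Uw Iw]; apply: UP => /=.
by rewrite set_valE insubdK //; exact/mem_set.
Qed.

Lemma interval_unchart_near (a : idx J) x : \forall z \near (chart a x),
  (z : 'rV[R]_1) 0 0 = ((@set_val R I) \o unchart a) z.
Proof.
have : \forall z \near (chart a x), I ((z : 'rV[R]_1) 0 0).
  apply: (@coord_continuous _ 1 1 0 0 (chart a x)).
  apply: open_nbhs_nbhs; split => //=.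
  by rewrite mxE; exact/set_mem/valP.
by apply: filterS => z Iz /=; rewrite set_valE insubdK //; exact/mem_set.
Qed.

Lemma is_derive_coord (z : 'rV[R]_1) (i : 'I_1) :
  is_derive z (ebase i) (fun w : 'rV[R]_1 => w 0 0) 1.
Proof.
have E h : (h *: (ebase i : 'rV[R]_1) + z) 0 0 = id (h *: (1 : R) + z 0 0).
  by rewrite !mxE !ord1 eqxx /=; congr (_ + _); rewrite mulr1.
split.
  exact: (@derivable_reparam _ _ _ _ (@id R) _ _ _ _ E (@derivable_id _ _ _ _)).
rewrite -[RHS](derive_id (z 0 0) (1 : R)).
exact: (@derive_reparam _ _ _ _ (@id R) _ _ _ _ E).
Qed.

Lemma is_derive_val (a : idx J) x (i : 'I_1) :
  is_derive (chart a x) (ebase i) ((@set_val R I) \o unchart a) 1.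
Proof.
by apply: near_eq_is_derive (interval_unchart_near a x) _; exact: is_derive_coord.
Qed.

Lemma interval_transition_smooth (a b : idx J) (j : 'I_1) :
  smooth_on a (dom a `&` dom b) (fun x => chart b x 0 j).
Proof.
rewrite (_ : (fun x => _) = @set_val R I); last by apply/funext => x; rewrite mxE.
case=> [|k] /=; split => //; try by move=> x _; exact: initial_continuous.
move=> i; split; first by move=> x _; have [] := is_derive_val a x i.
rewrite (_ : partial a i _ = fun=> 1); first exact: Ck_cst.
by apply/funext => x; have [] := is_derive_val a x i.
Qed.

Definition interval_manifold : manifold R 1 := {|
  carrier := set_type I;
  atlas := J;
  manifold_hausdorff := hausdorff_set_type (@Rhausdorff R);
  manifold_second_countable := second_countable_set_type I (@second_countable_real R);
  dom_open := fun=> openT;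
  dom_cover := fun x => ex_intro _ (tt : idx J) Logic.I;
  chart_open := interval_chart_open;
  chartK := interval_chartK;
  chart_continuous := interval_chart_continuous;
  unchart_continuous := interval_unchart_continuous;
  transition_smooth := interval_transition_smooth |}.
End OpenSet.

Section Geometry.
Context {R : realType} {n : nat} (M : manifold R n).
Implicit Types (a b : chart_of M) (x : M) (i j l m p : 'I_n).

Definition smooth (u : M -> R) : Prop := forall a, smooth_on a (dom a) u.

(* Tensor fields are given by their components in every chart of the atlas;
   [T a x] is meaningful for x in dom a, and the components in two charts are
   related by the usual transformation law, imposed by the predicates below. *)
Definition vfield := chart_of M -> M -> 'rV[R]_n.
Definition bilform := chart_of M -> M -> 'M[R]_n.

Definition vector_field (Z : vfield) : Prop :=
  (forall a j, smooth_on a (dom a) (fun x => Z a x 0 j)) /\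
  (forall a b x, dom a x -> dom b x -> Z b x = Z a x *m jac a b x).

Definition pseudo_riemannian (k : bilform) : Prop :=
  [/\ forall a i j, smooth_on a (dom a) (fun x => k a x i j),
      forall a b x, dom a x -> dom b x ->
        k a x = jac a b x *m k b x *m (jac a b x)^T,
      forall a x, dom a x -> (k a x)^T = k a x
    & forall a x, dom a x -> k a x \in unitmx].

Definition riemannian (k : bilform) : Prop :=
  pseudo_riemannian k /\
  forall a x, dom a x ->
    forall v : 'rV[R]_n, v != 0 -> 0 < (v *m k a x *m v^T) 0 0.

(* christoffel k a l i j = Gamma^l_{ij} *)
Definition christoffel (k : bilform) a l i j : M -> R := fun x =>
  2^-1 * \sum_(m < n) invmx (k a x) l m *
    (partial a i (fun y => k a y m j) x + partial a j (fun y => k a y i m) x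
     - partial a m (fun y => k a y i j) x).

(* R(d_i, d_j) d_l = sum_m (riemann k a i j l m) d_m, where
   R(X, Y) = [nabla_X, nabla_Y] - nabla_[X, Y]. *)
Definition riemann (k : bilform) a i j l m : M -> R := fun x =>
  partial a i (christoffel k a m j l) x - partial a j (christoffel k a m i l) x
  + \sum_(p < n) (christoffel k a m i p x * christoffel k a p j l x
                  - christoffel k a m j p x * christoffel k a p i l x).

(* Ric(Y, Z) = trace (X |-> R(X, Y) Z) *)
Definition ricci (k : bilform) : bilform := fun a x =>
  \matrix_(j, l) \sum_(i < n) riemann k a i j l i x.

Definition lie_metric (Z : vfield) (k : bilform) : bilform := fun a x =>
  \matrix_(i, j) \sum_(m < n)
    (Z a x 0 m * partial a m (fun y => k a y i j) x
     + k a x m j * partial a i (fun y => Z a y 0 m) x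
     + k a x i m * partial a j (fun y => Z a y 0 m) x).

Definition inner (k : bilform) (Y Z : vfield) a x : R :=
  (Y a x *m k a x *m (Z a x)^T) 0 0.

Definition grad (k : bilform) (u : M -> R) : vfield := fun a x =>
  (\row_j partial a j u x) *m invmx (k a x).

Definition divergence (k : bilform) (Z : vfield) a x : R :=
  \sum_(i < n) (partial a i (fun y => Z a y 0 i) x
                + \sum_(j < n) christoffel k a i i j x * Z a x 0 j).

Definition laplacian (k : bilform) (u : M -> R) : chart_of M -> M -> R :=
  divergence k (grad k u).

(* Z is conformal on (M, k) with factor 2 rho. *)
Definition conformal (k : bilform) (Z : vfield) (rho : M -> R) : Prop :=
  [/\ vector_field Z, smooth rho
    & forall a x, dom a x -> lie_metric Z k a x = (2 * rho x) *: k a x].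

Definition ricci_soliton (k : bilform) (Z : vfield) (lambda : R) : Prop :=
  [/\ pseudo_riemannian k, vector_field Z
    & forall a x, dom a x ->
        2^-1 *: lie_metric Z k a x + ricci k a x = lambda *: k a x].

Definition einstein (k : bilform) (mu : M -> R) : Prop :=
  forall a x, dom a x -> ricci k a x = mu x *: k a x.

End Geometry.

Section Warped.
Context {R : realType} (I : set R) (I_open : open I) (I_neq0 : I !=set0).
Local Notation IM := (interval_manifold I_open I_neq0).

(* The manifold I carries the single chart t, so a 1 x 1 matrix or row holds the
   component along d/dt; the chart index is tt. *)
Definition minus_dt2 : bilform IM := fun _ _ => (-1)%:M.
Definition h_dt (h : IM -> R) : vfield IM := fun _ t => const_mx (h t).

(* sigma (Delta^I sigma) + (n - 1) g_I(grad^I sigma, grad^I sigma); the factor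
   n - 1 is taken in R. *)
Definition diamond (n : nat) (sigma : IM -> R) (t : IM) : R :=
  sigma t * laplacian minus_dt2 sigma tt t
  + (n%:R - 1) * inner minus_dt2 (grad minus_dt2 sigma) (grad minus_dt2 sigma) tt t.

Context {n : nat} (M : manifold R n).

(* f^2 g_I (+) sigma^2 g with g_I = - dt^2, on I x M *)
Definition doubly_warped (f : M -> R) (sigma : IM -> R) (g : bilform M) :
    bilform (prod_manifold IM M) := fun c p =>
  block_mx (f p.2 ^+ 2 *: minus_dt2 c.1 p.1) 0
           0 (sigma p.1 ^+ 2 *: g c.2 p.2).

(* The sum of the lifts of Y and Z to I x M. *)
Definition lift_sum (Y : vfield IM) (Z : vfield M) :
    vfield (prod_manifold IM M) := fun c p => row_mx (Y c.1 p.1) (Z c.2 p.2).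

End Warped.

Section CkAlgebra.
Context {R : realType} {n : nat} (M : manifold R n) (a : chart_of M).
Variable U : set M.
Hypotheses (oU : open U) (Ua : U `<=` dom a).
Implicit Types u v : M -> R.

Lemma near_unchart x (P : set M) : U x -> nbhs x P ->
  \forall z \near (chart a x), P (unchart a z).
Proof.
move=> Ux xP; have ax := Ua Ux.
have Ic : (chart a @` dom a) (chart a x) by exists x.
by have := unchart_continuous Ic; rewrite /prop_for /continuous_at chartK //; apply.
Qed.

Lemma eq_near_unchart u v x : (forall x, U x -> u x = v x) -> U x ->
  \forall z \near (chart a x), (u \o unchart a) z = (v \o unchart a) z.
Proof.
move=> uv Ux; apply: filterS (near_unchart Ux (open_nbhs_nbhs (conj oU Ux))).
by move=> z; exact: uv.
Qed.

Lemma eq_Ck k u v : (forall x, U x -> u x = v x) -> Ck a U k u -> Ck a U k v.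
Proof.
elim: k u v => [|k IH] u v uv [uc ud].
all: have vc x : U x -> {for x, continuous v}.
1,3: move=> Ux; rewrite /prop_for /continuous_at -uv //; apply: cvg_trans (uc _ Ux);
  apply: near_eq_cvg; apply: filterS (open_nbhs_nbhs (conj oU Ux)) => y; exact: uv.
- by split.
split=> // i; have [d1 d2] := ud i; split.
  by move=> x Ux; apply: near_eq_derivable (d1 _ Ux); exact: eq_near_unchart.
by apply: IH d2 => x Ux; apply: near_eq_derive; exact: eq_near_unchart.
Qed.

Lemma Ck_S k u : Ck a U k.+1 u -> Ck a U k u.
Proof.
elim: k u => [|k IH] u [uc ud]; split => //.
by move=> i; have [d1 /IH d2] := ud i.
Qed.

Lemma CkD k u v : Ck a U k u -> Ck a U k v -> Ck a U k (fun x => u x + v x).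
Proof.
elim: k u v => [|k IH] u v [uc ud] [vc vd]; split => //.
1,2: by move=> x Ux; exact: continuousD (uc _ Ux) (vc _ Ux).
move=> i; have [d1 d2] := ud i; have [e1 e2] := vd i; split.
  by move=> x Ux; exact: derivableD (d1 _ Ux) (e1 _ Ux).
apply: eq_Ck (IH _ _ d2 e2) => x Ux.
by rewrite /partial -deriveD //; [exact: d1|exact: e1].
Qed.

Lemma CkM k u v : Ck a U k u -> Ck a U k v -> Ck a U k (fun x => u x * v x).
Proof.
elim: k u v => [|k IH] u v Cu Cv.
  have [uc _] := Cu; have [vc _] := Cv; split=> // x Ux.
  exact: continuousM (uc _ Ux) (vc _ Ux).
have [uc ud] := Cu; have [vc vd] := Cv; split=> [x Ux|i].
  exact: continuousM (uc _ Ux) (vc _ Ux).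
have [d1 d2] := ud i; have [e1 e2] := vd i; split.
  by move=> x Ux; exact: derivableM (d1 _ Ux) (e1 _ Ux).
apply: (eq_Ck _ (CkD (IH _ _ (Ck_S Cu) e2) (IH _ _ (Ck_S Cv) d2))) => x Ux.
have := deriveM (d1 _ Ux) (e1 _ Ux).
by rewrite /partial /= chartK; [move=> <-|exact: Ua].
Qed.

End CkAlgebra.

Lemma jac_prod (R : realType) m n (M : manifold R m) (N : manifold R n)
    (c d : chart_of (prod_manifold M N)) p :
  jac c d p = block_mx (jac c.1 d.1 p.1) 0 0 (jac c.2 d.2 p.2).
Proof.
apply/matrixP => i j; rewrite mxE.
case: (split_ordP i) => i' ->; case: (split_ordP j) => j' ->.
- rewrite block_mxEul mxE.
  rewrite (_ : (fun y => _) = fun y => (chart d.1 y.1 0 j')); last first.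
    by apply/funext => y /=; rewrite row_mxEl.
  by rewrite (@partial_fstl _ _ _ _ _ (atlas M) (atlas N) c i' (fun x => chart d.1 x 0 j')).
- rewrite block_mxEur mxE.
  rewrite (_ : (fun y => _) = fun y => (chart d.2 y.2 0 j')); last first.
    by apply/funext => y /=; rewrite row_mxEr.
  by rewrite (@partial_sndl _ _ _ _ _ (atlas M) (atlas N) c i' (fun x => chart d.2 x 0 j')).
- rewrite block_mxEdl mxE.
  rewrite (_ : (fun y => _) = fun y => (chart d.1 y.1 0 j')); last first.
    by apply/funext => y /=; rewrite row_mxEl.
  by rewrite (@partial_fstr _ _ _ _ _ (atlas M) (atlas N) c i' (fun x => chart d.1 x 0 j')).
rewrite block_mxEdr mxE.
rewrite (_ : (fun y => _) = fun y => (chart d.2 y.2 0 j')); last first.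
  by apply/funext => y /=; rewrite row_mxEr.
by rewrite (@partial_sndr _ _ _ _ _ (atlas M) (atlas N) c i' (fun x => chart d.2 x 0 j')).
Qed.

(* The data of a doubly warped product do define a pseudo-Riemannian metric and a
   vector field on I x M. *)
Section WarpedProps.
Context {R : realType} (I : set R) (I_open : open I) (I_neq0 : I !=set0).
Context {n : nat} (M : manifold R n).
Local Notation IM := (interval_manifold I_open I_neq0).
Variables (f : M -> R) (sigma : IM -> R) (g : bilform M).
Hypotheses (fs : smooth f) (f0 : forall x, 0 < f x).
Hypotheses (ss : smooth sigma) (s0 : forall x, 0 < sigma x).
Hypothesis gm : pseudo_riemannian g.

Lemma jac_interval (a b : chart_of IM) t : jac a b t = 1%:M.
Proof.
apply/matrixP => i j; rewrite !mxE !ord1 eqxx.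
rewrite (_ : (fun y : IM => _) = @set_val R I); last by apply/funext => x; rewrite mxE.
by have [] := @is_derive_val R I I_open I_neq0 a t 0.
Qed.

Lemma doubly_warped_pseudo_riemannian :
  pseudo_riemannian (doubly_warped f sigma g).
Proof.
have [g1 g2 g3 g4] := gm.
split.
- move=> c i j k.
  have odc : open (dom c) by exact: (@dom_open _ _ (prod_manifold IM M)).
  have Cf : Ck c (dom c) k (fun p => f p.2).
    apply: (@Ck_snd _ _ _ _ _ _ _ c (dom c.2) _ k f); first exact: fs.
    by move=> p [].
  have Cs : Ck c (dom c) k (fun p => sigma p.1).
    apply: (@Ck_fst _ _ _ _ _ _ _ c (dom c.1) _ k sigma); first exact: ss.
    by move=> p [].
  rewrite /doubly_warped.
  case: (split_ordP i) => i' ->; case: (split_ordP j) => j' ->.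
  + rewrite (_ : (fun x => _) = fun p => (f p.2 * f p.2) * ((-1)%:M : 'M_1) i' j').
      by apply: CkM => //; [exact: CkM|exact: Ck_cst].
    by apply/funext => p; rewrite block_mxEul mxE -expr2.
  + rewrite (_ : (fun x => _) = fun=> 0); first exact: Ck_cst.
    by apply/funext => p; rewrite block_mxEur mxE.
  + rewrite (_ : (fun x => _) = fun=> 0); first exact: Ck_cst.
    by apply/funext => p; rewrite block_mxEdl mxE.
  + rewrite (_ : (fun x => _) = fun p => (sigma p.1 * sigma p.1) * g c.2 p.2 i' j').
      apply: CkM => //; first exact: CkM.
      apply: (@Ck_snd _ _ _ _ _ _ _ c (dom c.2) _ k (fun x => g c.2 x i' j')).
        exact: g1.
      by move=> p [].
    by apply/funext => p; rewrite block_mxEdr mxE -expr2.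
- move=> c d p [c1 c2] [d1 d2].
  rewrite jac_prod /doubly_warped tr_block_mx !mulmx_block !trmx0.
  rewrite !(mulmx0, mul0mx, addr0, add0r) jac_interval trmx1 mulmx1 mul1mx.
  by rewrite -scalemxAr -scalemxAl -g2.
- move=> c p [c1 c2].
  by rewrite tr_block_mx !trmx0 !linearZ /= tr_scalar_mx g3.
move=> c p [c1 c2].
rewrite unitmxE det_ublock unitrM !detZ det_scalar1 !unitfE.
rewrite !mulf_neq0 ?expf_neq0 ?oppr_eq0 ?oner_neq0 ?(gt_eqF (f0 _)) ?(gt_eqF (s0 _)) //; first last.
by have := g4 _ _ c2; rewrite unitmxE unitfE.
Qed.

Lemma lift_sum_vector_field (h : IM -> R) (Z : vfield M) :
  smooth h -> vector_field Z -> vector_field (lift_sum (h_dt h) Z).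
Proof.
move=> hs [Z1 Z2]; split.
- move=> c j k; case: (split_ordP j) => j' ->.
    rewrite (_ : (fun x => _) = fun p => h p.1).
      apply: (@Ck_fst _ _ _ _ _ _ _ c (dom c.1) _ k h); first exact: hs.
      by move=> p [].
    by apply/funext => p; rewrite row_mxEl mxE.
  rewrite (_ : (fun x => _) = fun p => Z c.2 p.2 0 j').
    apply: (@Ck_snd _ _ _ _ _ _ _ c (dom c.2) _ k (fun x => Z c.2 x 0 j')).
      exact: Z1.
    by move=> p [].
  by apply/funext => p; rewrite row_mxEr.
move=> c d p [c1 c2] [d1 d2].
rewrite jac_prod /lift_sum mul_row_block !mulmx0 addr0 add0r jac_interval mulmx1.
by rewrite -Z2.
Qed.

End WarpedProps.

(* Main.v *)
(** Conformality turns the soliton equation into the pointwise identity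
    [Ric(gbar) = (lambda - rho) gbar].  When [f] is a constant [c], the only nonzero
    Christoffel symbols of [gbar = - c^2 dt^2 + sigma^2 g] are
    [Gamma^t_ij = (sigma sigma' / c^2) g_ij],
    [Gamma^l_tj = Gamma^l_jt = (sigma' / sigma) delta_lj] and those of [g], so on vectors
    tangent to [M] one gets
    [Ric(gbar) = Ric(g) + ((sigma sigma'' + (n - 1) sigma'^2) / c^2) g].
    Since [g_I = - dt^2], the coefficient of [g] is [- diamond sigma / c^2]. *)
Require Import Defs.
From mathcomp Require Import all_boot all_order all_algebra.
From mathcomp Require Import all_classical all_reals topology normedtype derive.
From mathcomp Require Import ring.
Set Implicit Arguments.
Unset Strict Implicit.
Unset Printing Implicit Defensive.
Import Order.TTheory GRing.Theory Num.Theory.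
Import numFieldTopology.Exports numFieldNormedType.Exports.
Local Open Scope classical_set_scope.
Local Open Scope ring_scope.

(** * Partial derivatives: locality, separated products, Leibniz rule *)

(** Component formulas hold only on [dom a]. That set is open, so they hold near the point, and this
    is enough to differentiate them. *)
Lemma near_eq_partial {R : realType} {n : nat} (M : manifold R n)
    (a : chart_of M) (i : 'I_n) (u v : M -> R) (x : M) : dom a x ->
  (forall y, dom a y -> u y = v y) -> partial a i u x = partial a i v x.
Proof.
move=> ax uv; apply: near_eq_derive.
by apply: (@eq_near_unchart _ _ _ a (dom a)) => //; exact: dom_open.
Qed.

Section ProductPartials.
Context {R : realType} {m n : nat} {M : manifold R m} {N : manifold R n}.
Variables (c : chart_of (prod_manifold M N)) (u : M -> R) (v : N -> R).

(** Along a coordinate line of the first factor the second point stays at [p.2], so [v] acts as the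
    constant scalar [v p.2]. *)
Lemma partial_mul_l i p : dom c p ->
  derivable (u \o unchart c.1) (chart c.1 p.1) (ebase i) ->
  partial c (lshift n i) (fun q => u q.1 * v q.2) p
  = partial c.1 i u p.1 * v p.2.
Proof.
move=> [c1 c2] du; rewrite mulrC -[RHS](deriveZ _ du).
apply: derive_reparam => s /=.
by rewrite !linearD !linearZ /= row_mxKl row_mxKr lsub_ebase rsub_ebase0
  scaler0 add0r chartK // mulrC.
Qed.

Lemma partial_mul_r i p : dom c p ->
  derivable (v \o unchart c.2) (chart c.2 p.2) (ebase i) ->
  partial c (rshift m i) (fun q => u q.1 * v q.2) p
  = u p.1 * partial c.2 i v p.2.
Proof.
move=> [c1 c2] dv; rewrite -[RHS](deriveZ _ dv).
apply: derive_reparam => s /=.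
by rewrite !linearD !linearZ /= row_mxKl row_mxKr rsub_ebase lsub_ebase0
  scaler0 add0r chartK.
Qed.
End ProductPartials.

Section PartialAlgebra.
Context {R : realType} {n : nat} {M : manifold R n}.
Variables (a : chart_of M) (i : 'I_n) (x : M).
Hypothesis ax : dom a x.

Lemma smooth_derivable u : smooth_on a (dom a) u ->
  derivable (u \o unchart a) (chart a x) (ebase i).
Proof. by move=> /(_ 1%N) [_ /(_ i) [+ _]]; exact. Qed.

Lemma smooth_partial u : smooth_on a (dom a) u ->
  smooth_on a (dom a) (partial a i u).
Proof. by move=> us k; have [_ /(_ i) []] := us k.+1. Qed.

Lemma smooth_mul u v : smooth_on a (dom a) u -> smooth_on a (dom a) v ->
  smooth_on a (dom a) (fun y => u y * v y).
Proof. by move=> us vs k; apply: CkM => //; exact: dom_open. Qed.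

Lemma partial_mul u v : smooth_on a (dom a) u -> smooth_on a (dom a) v ->
  partial a i (fun y => u y * v y) x = u x * partial a i v x + v x * partial a i u x.
Proof.
move=> /smooth_derivable du /smooth_derivable dv.
by have := deriveM du dv; rewrite /partial /= chartK.
Qed.

Lemma partial_opp u : smooth_on a (dom a) u ->
  partial a i (fun y => - u y) x = - partial a i u x.
Proof. by move=> /smooth_derivable du; exact: (deriveN du). Qed.
End PartialAlgebra.

(** * The warped metric with constant [f]: components and inverse *)

Section WarpedConstantLapse.
Context {R : realType} (I : set R) (I_open : open I) (I_neq0 : I !=set0).
Context {n : nat} (M : manifold R n).
Local Notation IM := (interval_manifold I_open I_neq0).
Variables (c : R) (sigma : IM -> R) (g : bilform M).
Hypotheses (c_neq0 : c != 0) (sigma_smooth : smooth sigma).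
Hypotheses (sigma_neq0 : forall t, sigma t != 0) (g_pseudo : pseudo_riemannian g).

Local Notation K := (doubly_warped (fun=> c) sigma g).
Local Notation dsigma := (partial (tt : chart_of IM) 0 sigma).
Local Notation ddsigma := (partial (tt : chart_of IM) 0 dsigma).
Local Notation tdir := (lshift n (0 : 'I_1)).
Local Notation xdir := (@rshift 1 n).

Variable b : chart_of (prod_manifold IM M).
Implicit Types p : prod_manifold IM M.

(** This and the next three are equalities of functions, so that they can rewrite the argument of
    [partial]. *)
Lemma warpedTT : (fun p => K b p tdir tdir) = fun=> - c ^+ 2.
Proof. by apply/funext => p; rewrite /doubly_warped block_mxEul !mxE mulrN1. Qed.

Lemma warpedTX i : (fun p => K b p tdir (xdir i)) = fun=> 0.
Proof. by apply/funext => p; rewrite /doubly_warped block_mxEur !mxE. Qed.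

Lemma warpedXT i : (fun p => K b p (xdir i) tdir) = fun=> 0.
Proof. by apply/funext => p; rewrite /doubly_warped block_mxEdl !mxE. Qed.

Lemma warpedXX i j :
  (fun p => K b p (xdir i) (xdir j)) = fun p => sigma p.1 * sigma p.1 * g b.2 p.2 i j.
Proof. by apply/funext => p; rewrite /doubly_warped block_mxEdr !mxE expr2. Qed.

Lemma sigma_chart_smooth (a : chart_of IM) : smooth_on a (dom a) sigma.
Proof. exact: sigma_smooth. Qed.

(** The interval has a single chart, so [dsigma], taken in [tt], also serves for the component [b.1]
    of an arbitrary product chart. *)
Lemma interval_partialE (a : chart_of IM) (u : IM -> R) :
  partial a 0 u = partial (tt : chart_of IM) 0 u.
Proof. by case: a. Qed.

Lemma partialT_warpedXX i j p : dom b p ->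
  partial b tdir (fun q => K b q (xdir i) (xdir j)) p
  = 2 * sigma p.1 * dsigma p.1 * g b.2 p.2 i j.
Proof.
move=> bp; have [b1 b2] := bp.
have ss := smooth_mul (sigma_chart_smooth b.1) (sigma_chart_smooth b.1).
rewrite warpedXX (@partial_mul_l _ _ _ _ _ b (fun t => sigma t * sigma t)
  (fun x => g b.2 x i j)) //; last exact: smooth_derivable.
by rewrite partial_mul // interval_partialE; ring.
Qed.

Lemma partialX_warpedXX i j l p : dom b p ->
  partial b (xdir l) (fun q => K b q (xdir i) (xdir j)) p
  = sigma p.1 ^+ 2 * partial b.2 l (fun x => g b.2 x i j) p.2.
Proof.
move=> bp; have [b1 b2] := bp; have [g_smooth _ _ _] := g_pseudo.
rewrite warpedXX (@partial_mul_r _ _ _ _ _ b (fun t => sigma t * sigma t)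
  (fun x => g b.2 x i j)) //; exact: smooth_derivable.
Qed.

Lemma invmx_warped p : dom b p -> invmx (K b p) =
  block_mx (- (c ^+ 2)^-1)%:M 0 0 ((sigma p.1 ^+ 2)^-1 *: invmx (g b.2 p.2)).
Proof.
move=> [b1 b2]; have [_ _ _ g_unit] := g_pseudo.
have c2 : c ^+ 2 != 0 by rewrite expf_neq0.
have s2 : sigma p.1 ^+ 2 != 0 by rewrite expf_neq0.
(* A right inverse suffices: for square matrices it forces invertibility and equals [invmx]. *)
have E : K b p *m block_mx (- (c ^+ 2)^-1)%:M 0 0
    ((sigma p.1 ^+ 2)^-1 *: invmx (g b.2 p.2)) = 1%:M.
  rewrite /doubly_warped mulmx_block !(mulmx0, mul0mx, addr0, add0r).
  rewrite -!scalemxAl -!scalemxAr mulmxV ?g_unit // scalerA divff // scale1r.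
  rewrite /minus_dt2 -scalar_mxM scale_scalar_mx mulN1r opprK divff //.
  by rewrite -scalar_mx_block.
have [U _] := mulmx1_unit E.
by rewrite -[RHS]mul1mx -(mulVmx U) -mulmxA E mulmx1.
Qed.

(** * Christoffel symbols of the warped metric *)

Lemma christoffelT_warped i j p : dom b p -> christoffel K b tdir i j p =
  - (2 * c ^+ 2)^-1 * (partial b i (fun q => K b q tdir j) p
    + partial b j (fun q => K b q i tdir) p - partial b tdir (fun q => K b q i j) p).
Proof.
(* The inverse metric has no mixed entries, so only the summand with m = t survives. *)
move=> bp; rewrite /christoffel big_split_ord /= big_ord1 [X in _ + X]big1.
  rewrite invmx_warped // block_mxEul mxE addr0 eqxx mulr1n.
  by rewrite mulrA mulrN -invfM.
by move=> m _; rewrite invmx_warped // block_mxEur mxE mul0r.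
Qed.

Lemma christoffelX_warped l i j p : dom b p -> christoffel K b (xdir l) i j p =
  (2 * sigma p.1 ^+ 2)^-1 * \sum_m invmx (g b.2 p.2) l m *
   (partial b i (fun q => K b q (xdir m) j) p + partial b j (fun q => K b q i (xdir m)) p
    - partial b (xdir m) (fun q => K b q i j) p).
Proof.
move=> bp; rewrite /christoffel big_split_ord /= big_ord1.
rewrite invmx_warped // block_mxEdl mxE mul0r add0r (invfM 2) -mulrA; congr (_ * _).
by rewrite mulr_sumr; apply: eq_bigr => m _; rewrite block_mxEdr mxE !mulrA.
Qed.

(** In these names the first letter is the upper index and the other two the lower ones: T for d/dt,
    X for a direction of [M]. *)
Lemma christoffelTTT p : dom b p -> christoffel K b tdir tdir tdir p = 0.
Proof.
by move=> bp; rewrite christoffelT_warped // !warpedTT !partial_cst subr0 addr0 mulr0.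
Qed.

Lemma christoffelTTX j p : dom b p -> christoffel K b tdir tdir (xdir j) p = 0.
Proof.
move=> bp; rewrite christoffelT_warped // !warpedTT !warpedTX !partial_cst.
by rewrite subr0 addr0 mulr0.
Qed.

Lemma christoffelTXT j p : dom b p -> christoffel K b tdir (xdir j) tdir p = 0.
Proof.
move=> bp; rewrite christoffelT_warped // !warpedTT !warpedXT !partial_cst.
by rewrite subr0 addr0 mulr0.
Qed.

Lemma christoffelTXX i j p : dom b p -> christoffel K b tdir (xdir i) (xdir j) p =
  sigma p.1 * dsigma p.1 / c ^+ 2 * g b.2 p.2 i j.
Proof.
move=> bp; rewrite christoffelT_warped // partialT_warpedXX // !warpedTX !warpedXT.
by rewrite !partial_cst; field.
Qed.

(** Only the t-derivative of sigma^2 g_mj is nonzero, and contracting g_mj with the inverse of [g]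
    yields the Kronecker delta. *)
Lemma christoffelXTX l j p : dom b p ->
  christoffel K b (xdir l) tdir (xdir j) p = dsigma p.1 / sigma p.1 * (l == j)%:R.
Proof.
move=> bp; have [b1 b2] := bp; have [_ _ _ g_unit] := g_pseudo.
rewrite christoffelX_warped //.
under eq_bigr do rewrite partialT_warpedXX // !warpedTX !partial_cst subr0 addr0 mulrCA.
rewrite -mulr_sumr.
have -> : \sum_m invmx (g b.2 p.2) l m * g b.2 p.2 m j = (l == j)%:R.
  by have := mulVmx (g_unit _ _ b2) => /matrixP /(_ l j); rewrite !mxE.
by field.
Qed.

Lemma christoffelXXT l i p : dom b p ->
  christoffel K b (xdir l) (xdir i) tdir p = dsigma p.1 / sigma p.1 * (l == i)%:R.
Proof.
move=> bp; have [b1 b2] := bp; have [_ _ g_sym _] := g_pseudo.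
rewrite -christoffelXTX // !christoffelX_warped //; congr (_ * _).
apply: eq_bigr => m _; rewrite !partialT_warpedXX // !warpedXT !warpedTX !partial_cst.
have := g_sym _ _ b2 => /matrixP /(_ m i); rewrite mxE => ->.
by rewrite add0r addr0.
Qed.

(** Derivatives along [M] treat sigma^2 as a constant, which cancels the sigma^-2 of the inverse
    metric: constant scaling preserves the Levi-Civita connection. *)
Lemma christoffelXXX l i j p : dom b p ->
  christoffel K b (xdir l) (xdir i) (xdir j) p = christoffel g b.2 l i j p.2.
Proof.
move=> bp; rewrite christoffelX_warped // /christoffel.
under eq_bigr do rewrite !partialX_warpedXX // -mulrDr -mulrBr mulrCA.
by rewrite -mulr_sumr; field.
Qed.

(** * Curvature components and Ricci tensor along [M] *)

Lemma riemannT_warped j l p : dom b p -> riemann K b tdir (xdir j) (xdir l) tdir p =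
  sigma p.1 * ddsigma p.1 / c ^+ 2 * g b.2 p.2 j l.
Proof.
move=> bp; have [b1 b2] := bp; rewrite /riemann.
(* The symbol is put in separated form, a function of t times a function on [M], as [partial_mul_l]
   requires. *)
rewrite (@near_eq_partial _ _ _ b tdir _
  (fun q => (sigma q.1 * dsigma q.1) * ((c ^+ 2)^-1 * g b.2 q.2 j l))) //; last first.
  by move=> q bq; rewrite christoffelTXX // !mulrA.
rewrite (@near_eq_partial _ _ _ b (xdir j) _ (fun=> 0)) //; last first.
  by move=> q bq; rewrite christoffelTTX.
have s1 : smooth_on b.1 (dom b.1) dsigma.
  by rewrite -(interval_partialE b.1); apply: smooth_partial.
have ss := smooth_mul (sigma_chart_smooth b.1) s1.
rewrite (@partial_mul_l _ _ _ _ _ b (fun t => sigma t * dsigma t)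
  (fun x => (c ^+ 2)^-1 * g b.2 x j l)) //; last exact: smooth_derivable.
rewrite partial_mul //.
rewrite partial_cst big_split_ord /= big_ord1 christoffelTTT // christoffelTTX //.
rewrite christoffelTXT // !mul0r subrr add0r.
under eq_bigr do
  rewrite christoffelTTX // mul0r christoffelTXX // christoffelXTX // sub0r.
(* The delta keeps only m = l; that term cancels the sigma'^2 created by differentiating sigma
   sigma' in t. *)
rewrite (bigD1 l) //= eqxx mulr1n big1; last first.
  by move=> m /negPf ->; rewrite mulr0n !mulr0 oppr0.
by rewrite !interval_partialE; field; rewrite ?c_neq0 sigma_neq0.
Qed.

(** By [christoffelXXX], all terms with indices in [M] add up to the curvature of [g]. The
    correction, as in the Gauss equation, is the summand whose intermediate index is t. *)
Lemma riemannX_warped i j l p : dom b p ->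
  riemann K b (xdir i) (xdir j) (xdir l) (xdir i) p =
  riemann g b.2 i j l i p.2 +
  dsigma p.1 ^+ 2 / c ^+ 2 * (g b.2 p.2 j l - (i == j)%:R * g b.2 p.2 i l).
Proof.
move=> bp; have [b1 b2] := bp; rewrite /riemann.
have E m d e o : partial b (xdir o) (christoffel K b (xdir m) (xdir d) (xdir e)) p
    = partial b.2 o (christoffel g b.2 m d e) p.2.
  have -> := near_eq_partial (xdir o) bp (fun q bq => christoffelXXX m d e bq).
  by rewrite (@partial_sndr _ _ _ _ _ (atlas IM) (atlas M) b o (christoffel g b.2 m d e)).
rewrite !E big_split_ord /= big_ord1 -!addrA; congr (_ + (_ + _)).
under eq_bigr do rewrite !christoffelXXX //.
rewrite [LHS]addrA [LHS]addrC; congr (_ + _).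
rewrite !christoffelXXT // !christoffelTXX // eqxx mulr1n.
by field; rewrite ?c_neq0 sigma_neq0.
Qed.

(** The metric [minus_dt2] has constant coefficient -1: its Christoffel symbol vanishes and the
    gradient is [- dsigma], so the Laplacian and the squared gradient both carry a minus sign. *)
Lemma diamondE t :
  diamond n sigma t = - (sigma t * ddsigma t + (n%:R - 1) * dsigma t ^+ 2).
Proof.
have gradE s : grad (@minus_dt2 _ _ I_open I_neq0) sigma tt s = (- dsigma s)%:M.
  apply/matrixP => i j; rewrite /grad /minus_dt2 invmx_scalar invrN1 mul_mx_scalar.
  by rewrite !mxE !ord1 mulN1r.
rewrite /diamond /laplacian /divergence /inner !big_ord1 !gradE.
rewrite (_ : (fun s => grad _ _ _ _ _ _) = fun s => - dsigma s); last first.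
  by apply/funext => s; rewrite gradE mxE.
rewrite partial_opp //; last exact: smooth_partial.
have -> : christoffel (@minus_dt2 _ _ I_open I_neq0) tt 0 0 0 t = 0.
  by rewrite /christoffel big_ord1 partial_cst addr0 subr0 !mulr0.
by rewrite tr_scalar_mx -!scalar_mxM !mxE /=; ring.
Qed.

Lemma ricciXX_warped j l p : dom b p -> ricci K b p (xdir j) (xdir l) =
  ricci g b.2 p.2 j l - diamond n sigma p.1 / c ^+ 2 * g b.2 p.2 j l.
Proof.
move=> bp; rewrite !mxE big_split_ord /= big_ord1 riemannT_warped //.
under eq_bigr do rewrite riemannX_warped //.
rewrite big_split /= -mulr_sumr sumrB sumr_const card_ord.
rewrite [LHS]addrCA; congr (_ + _).
(* The delta removes one of the n copies of g_jl, whence the factor n - 1. *)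
rewrite (bigD1 j) //= eqxx mulr1n big1; last by move=> m /negPf ->; rewrite mul0r.
by rewrite -mulr_natl diamondE; field.
Qed.
End WarpedConstantLapse.

(** * The Einstein equation from the block tangent to [M] *)

Theorem theorem14 (R : realType)
    (I : set R) (I_open : open I) (I_neq0 : I !=set0) (I_conn : connected I)
    (n : nat) (M : manifold R n) (g : bilform M) (g_riem : riemannian g)
    (f : M -> R) (f_smooth : smooth f) (f_gt0 : forall x, 0 < f x)
    (sigma : interval_manifold I_open I_neq0 -> R)
    (sigma_smooth : smooth sigma) (sigma_gt0 : forall t, 0 < sigma t)
    (h : interval_manifold I_open I_neq0 -> R) (h_smooth : smooth h)
    (zeta : vfield M) (zeta_field : vector_field zeta)
    (rho : prod_manifold (interval_manifold I_open I_neq0) M -> R)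
    (lambda : R)
    (soliton : ricci_soliton (doubly_warped f sigma g)
                 (lift_sum (h_dt h) zeta) lambda)
    (zeta_conformal : conformal (doubly_warped f sigma g)
                        (lift_sum (h_dt h) zeta) rho)
    (f_const : exists c, forall x, f x = c) :
  forall t : interval_manifold I_open I_neq0,
    einstein g (fun x => (lambda - rho (t, x)) * sigma t ^+ 2
                         + diamond n sigma t / f x ^+ 2).
Proof.
move=> t a x ax; have [c fc] := f_const.
have c_neq0 : c != 0 by rewrite -(fc x) gt_eqF.
have fE : f = fun=> c by exact/funext.
have [g_pseudo _] := g_riem; have sigma_neq0 s : sigma s != 0 by rewrite gt_eqF.
(* Any chart of [M] extends by the chart of the interval to a product chart around (t, x). *)
pose b : chart_of (prod_manifold (interval_manifold I_open I_neq0) M) := (tt, a).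
have btx : dom b (t, x) by [].
have [_ _ /(_ b (t, x) btx) Ric] := soliton.
have [_ _ /(_ b (t, x) btx) Lie] := zeta_conformal.
apply/matrixP => j l.
move: Ric; rewrite Lie fE => /matrixP /(_ (rshift 1 j) (rshift 1 l)).
rewrite [LHS]mxE ricciXX_warped // [RHS]mxE 2![in LHS]mxE /doubly_warped.
rewrite block_mxEdr [in LHS]mxE [in RHS]mxE /= => Ric; rewrite [RHS]mxE.
(* The (j, l) entry of the soliton equation is solved for Ric(g); the 1/2 then cancels the 2 of the
   conformal factor, leaving lambda - rho. *)
have -> : ricci g a x j l = lambda * (sigma t ^+ 2 * g a x j l)
    - 2^-1 * (2 * rho (t, x) * (sigma t ^+ 2 * g a x j l))
    + diamond n sigma t / c ^+ 2 * g a x j l by rewrite -Ric; ring.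
by field.
Qed.
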